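(* Let $N,M\ge 1$ be integers and let $\mathbf x^1,\dots,\mathbf x^M,\mathbf y^1,\dots,\mathbf y^M\in\mathbb R^N$. Let $\mathbf X=[\mathbf x^1\,\cdots\,\mathbf x^M]$ and $\mathbf Y=[\mathbf y^1\,\cdots\,\mathbf y^M]$ in $\mathbb R^{N\times M}$. Let $\mathbf B\in\mathbb R^{N\times N}$ be the residual DMD (rDMD) matrix and $(\mathbf B_{\mathrm g},\mathbf b)\in\mathbb R^{N\times N}\times\mathbb R^N$ the extended DMD (xDMD) pair of the data $(\mathbf X,\mathbf Y)$. Then $$\frac1M\sum_{k=1}^M\|\mathbf y^k-\mathbf x^k-\mathbf B_{\mathrm g}\mathbf x^k-\mathbf b\|^2\;\le\;\frac1M\sum_{k=1}^M\|\mathbf y^k-\mathbf x^k-\mathbf B\mathbf x^k\|^2 .$$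
   Context: $\|\cdot\|$ is the Euclidean norm on $\mathbb R^N$ and $\dagger$ denotes the Moore–Penrose inverse. Residual DMD (rDMD): $\mathbf B=(\mathbf Y-\mathbf X)\mathbf X^\dagger$. Extended DMD (xDMD): $[\mathbf B_{\mathrm g},\mathbf b]=(\mathbf Y-\mathbf X)\tilde{\mathbf X}^\dagger$, where $\tilde{\mathbf X}=\begin{bmatrix}\mathbf X\\ \mathbf 1\end{bmatrix}\in\mathbb R^{(N+1)\times M}$ and $\mathbf 1=[1,1,\dots,1]$ is the $1\times M$ row of ones; $\mathbf B_{\mathrm g}$ consists of the first $N$ columns of this $N\times(N+1)$ matrix and $\mathbf b$ is its last column. *)

(* Defs.v *)
From HB Require Import structures.
From mathcomp Require Import all_boot all_order all_algebra.
From mathcomp Require Import reals.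

Set Implicit Arguments.
Unset Strict Implicit.
Unset Printing Implicit Defensive.

Import Order.TTheory GRing.Theory Num.Theory.
Local Open Scope ring_scope.

(* The library's norm on matrices is the sup norm, hence this definition. *)
Definition enorm (R : realType) (n : nat) (v : 'cV[R]_n) : R :=
  Num.sqrt (\sum_(i < n) v i 0 ^+ 2).

(* The four Penrose conditions; over the reals the adjoint is the transpose. *)
Definition is_pinv (R : realType) (m n : nat) (A : 'M[R]_(m, n)) :
    pred 'M[R]_(n, m) :=
  fun P => [&& A *m P *m A == A,
               P *m A *m P == P,
               (A *m P)^T == A *m P &
               (P *m A)^T == P *m A].

Lemma mul_trmx_eq0 (R : realType) (n : nat) (v : 'rV[R]_n) :
  v *m v^T = 0 -> v = 0.
Proof.
move=> /matrixP/(_ 0 0); rewrite !mxE => /eqP.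
rewrite psumr_eq0 => [/allP v0|i _]; last by rewrite mxE -expr2 sqr_ge0.
apply/rowP => i; have := v0 i (mem_index_enum _).
by rewrite /= mxE -expr2 sqrf_eq0 mxE => /eqP.
Qed.

Lemma gram_unit (R : realType) (m n : nat) (A : 'M[R]_(m, n)) :
  row_free A -> A *m A^T \in unitmx.
Proof.
move=> fA; rewrite -row_free_unit; apply: inj_row_free => v vG0.
apply/eqP; rewrite -(mulmx_free_eq0 v fA); apply/eqP/mul_trmx_eq0.
by rewrite trmx_mul mulmxA -(mulmxA v) vG0 mul0mx.
Qed.

Lemma pinv_exists (R : realType) (m n : nat) (A : 'M[R]_(m, n)) :
  exists P, is_pinv A P.
Proof.
have uF := gram_unit (row_base_free A).
have fC : row_free (col_base A)^T.
  by have := col_base_full A; rewrite /row_free /row_full mxrank_tr.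
have := gram_unit fC; rewrite trmxK => uC {fC}.
rewrite -(mulmx_base A).
move: (col_base A) (row_base A) uF uC => C F uF uC.
have sF : (invmx (F *m F^T))^T = invmx (F *m F^T).
  by rewrite trmx_inv trmx_mul trmxK.
have sC : (invmx (C^T *m C))^T = invmx (C^T *m C).
  by rewrite trmx_inv trmx_mul trmxK.
pose Fp := F^T *m invmx (F *m F^T); pose Cp := invmx (C^T *m C) *m C^T.
have FFp : F *m Fp = 1%:M by rewrite /Fp mulmxA mulmxV.
have CpC : Cp *m C = 1%:M by rewrite /Cp -mulmxA mulVmx.
have AP : C *m F *m (Fp *m Cp) = C *m Cp.
  by rewrite -mulmxA (mulmxA F) FFp mul1mx.
have PA : Fp *m Cp *m (C *m F) = Fp *m F.
  by rewrite -mulmxA (mulmxA Cp) CpC mul1mx.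
exists (Fp *m Cp); rewrite /is_pinv AP PA; apply/and4P; split; apply/eqP.
- by rewrite -mulmxA (mulmxA Cp) CpC mul1mx.
- by rewrite -mulmxA (mulmxA F) FFp mul1mx.
- by rewrite /Cp !trmx_mul trmxK sC mulmxA.
- by rewrite /Fp !trmx_mul trmxK sF mulmxA.
Qed.

Definition pinv (R : realType) (m n : nat) (A : 'M[R]_(m, n)) : 'M[R]_(n, m) :=
  xchoose (pinv_exists A).

Lemma pinvP (R : realType) (m n : nat) (A : 'M[R]_(m, n)) : is_pinv A (pinv A).
Proof. exact: xchooseP. Qed.

Lemma pinv_unique (R : realType) (m n : nat) (A : 'M[R]_(m, n))
    (P : 'M[R]_(n, m)) :
  is_pinv A P -> P = pinv A.
Proof.
move: (pinv A) (pinvP A) => Q.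
case/and4P=> /eqP AQA /eqP QAQ /eqP sAQ /eqP sQA.
case/and4P=> /eqP APA /eqP PAP /eqP sAP /eqP sPA.
have e1 : A *m P = A *m Q.
  by rewrite -sAP -{1}AQA -mulmxA trmx_mul sAP sAQ mulmxA APA.
have e2 : P *m A = Q *m A.
  rewrite -sPA -{1}AQA -(mulmxA A) mulmxA trmx_mul sPA sQA.
  by rewrite -mulmxA (mulmxA A) APA.
by rewrite -PAP e2 -mulmxA e1 mulmxA QAQ.
Qed.

Definition data_mx (R : realType) (N M : nat) (x : 'I_M -> 'cV[R]_N) :
    'M[R]_(N, M) :=
  \matrix_(i < N, k < M) x k i 0.

Definition rDMD (R : realType) (N M : nat) (X Y : 'M[R]_(N, M)) : 'M[R]_N :=
  (Y - X) *m pinv X.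

Definition augment (R : realType) (N M : nat) (X : 'M[R]_(N, M)) :
    'M[R]_(N + 1, M) :=
  col_mx X (const_mx 1).

Definition xDMD (R : realType) (N M : nat) (X Y : 'M[R]_(N, M)) :
    'M[R]_N * 'cV[R]_N :=
  let K : 'M[R]_(N, N + 1) := (Y - X) *m pinv (augment X) in
  (lsubmx K, rsubmx K).

(* Main.v *)
Require Import Defs.
From HB Require Import structures.
From mathcomp Require Import all_boot all_order all_algebra.
From mathcomp Require Import reals.

Import Order.TTheory GRing.Theory Num.Theory.
Local Open Scope ring_scope.

(** Both errors are squared Frobenius norms of residuals of [Y - X]: the xDMD
    one is the residual of [(Y - X) (augment X)^+ (augment X)], a least-squares
    minimizer over all [K *m augment X], and the rDMD model is the competitor
    [K = [B, 0]]. *)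

Lemma sum_enorm_sq (R : realType) (N M : nat) (E : 'M[R]_(N, M)) :
  \sum_(k < M) enorm (col k E) ^+ 2 = \tr (E *m E^T).
Proof.
rewrite /mxtrace (eq_bigr (fun k => \sum_(i < N) E i k ^+ 2)) => [|k _].
  rewrite exchange_big; apply: eq_bigr => i _.
  by rewrite mxE; apply: eq_bigr => k _; rewrite mxE expr2.
rewrite /enorm sqr_sqrtr; last by apply: sumr_ge0 => i _; rewrite sqr_ge0.
by apply: eq_bigr => i _; rewrite mxE.
Qed.

Lemma mxtrace_mul_tr_ge0 (R : realType) (N M : nat) (E : 'M[R]_(N, M)) :
  0 <= \tr (E *m E^T).
Proof. by rewrite -sum_enorm_sq; apply: sumr_ge0 => k _; rewrite sqr_ge0. Qed.

(** Pythagoras for the trace inner product: [pinv A *m A] is the orthogonal projector onto the row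
    space of [A]. It kills the residual [U] and fixes [V], the difference of the two fits, so [U]
    and [V] are orthogonal. *)
Lemma pinv_least_squares (R : realType) (m n p : nat)
    (A : 'M[R]_(m, n)) (D : 'M[R]_(p, n)) (K : 'M[R]_(p, m)) :
  \tr ((D - D *m pinv A *m A) *m (D - D *m pinv A *m A)^T)
    <= \tr ((D - K *m A) *m (D - K *m A)^T).
Proof.
set U := D - D *m pinv A *m A.
case/and4P: (pinvP A) => /eqP APA _ _ /eqP sPA.
pose V := (D *m pinv A - K) *m A.
have resK : D - K *m A = U + V by rewrite /V mulmxBl addrA subrK.
have VP : V *m (pinv A *m A) = V by rewrite -mulmxA [A *m _]mulmxA APA.
have UP0 : U *m (pinv A *m A) = 0.
  by rewrite mulmxBl -!mulmxA [A *m (_ *m _)]mulmxA APA subrr.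
(* Symmetry of the projector moves it from [V] onto [U]. *)
have UV0 : U *m V^T = 0 by rewrite -VP trmx_mul sPA mulmxA UP0 mul0mx.
have VU0 : V *m U^T = 0 by rewrite -[V *m _]trmxK trmx_mul trmxK UV0 trmx0.
rewrite resK; move: U V UV0 VU0 {resK VP UP0} => U V UV0 VU0.
rewrite [(U + V)^T]raddfD /= mulmxDl !mulmxDr UV0 VU0 addr0 add0r mxtraceD.
by rewrite lerDl mxtrace_mul_tr_ge0.
Qed.

(** The row of ones in [augment] absorbs the offset [b], making the affine model linear in the
    augmented data. *)
Lemma sum_enorm_affine_residual (R : realType) (N M : nat)
    (x y : 'I_M -> 'cV[R]_N) (B : 'M[R]_N) (b : 'cV[R]_N) :
  let E := data_mx y - data_mx x - row_mx B b *m augment (data_mx x) in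
  \sum_(k < M) enorm (y k - x k - B *m x k - b) ^+ 2 = \tr (E *m E^T).
Proof.
move=> E; rewrite -sum_enorm_sq; apply: eq_bigr => k _; congr (enorm _ ^+ 2).
apply/colP => i; rewrite /E /augment mul_row_col !mxE big_ord1 !mxE mulr1.
rewrite opprD addrA; congr (_ - _ - _).
by apply: eq_bigr => j _; rewrite !mxE.
Qed.

Theorem mainTheorem3 (R : realType) (N M : nat) (hN : (1 <= N)%N)
    (hM : (1 <= M)%N) (x y : 'I_M -> 'cV[R]_N) :
  let X := data_mx x in
  let Y := data_mx y in
  let B := rDMD X Y in
  let Bg := (xDMD X Y).1 in
  let b := (xDMD X Y).2 in
  M%:R^-1 * \sum_(k < M) enorm (y k - x k - Bg *m x k - b) ^+ 2
    <= M%:R^-1 * \sum_(k < M) enorm (y k - x k - B *m x k) ^+ 2.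
Proof.
move=> /=; apply: ler_wpM2l; first by rewrite invr_ge0 ler0n.
(* Subtracting a zero offset puts the rDMD residual in affine form, with [b = 0]. *)
under [leRHS]eq_bigr do rewrite -[y _ - _ - _]subr0.
(* [hsubmxK] glues the two xDMD blocks back into the least-squares matrix. *)
rewrite !sum_enorm_affine_residual hsubmxK.
exact: pinv_least_squares.
Qed.
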